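(* There is an absolute constant $C$ such that for every integer $n\geq 2$, $\left|\mathrm{lcc}(K^\nabla_{n,n})-\left(\frac{1}{2}\log n+\frac{1}{4}\log\log n\right)\right|\leq C$; that is, $\mathrm{lcc}(K^\nabla_{n,n})=\frac{1}{2}\log n+\frac{1}{4}\log\log n+O(1)$.
   Context: For a positive integer $n$, $K^\nabla_{n,n}$ is the graph on vertex set $\{1,\ldots,2n\}$ in which $X=\{1,\ldots,n\}$ and $Y=\{n+1,\ldots,2n\}$ are cliques and, for $i\in X$ and $j\in Y$, $i$ is adjacent to $j$ iff $j\leq n+i$ (equivalently, the linear interval graph on points $1,\ldots,2n$ with intervals $[i,n+i]$, $1\leq i\leq n$). A clique covering of a graph $G$ is a family $\mathcal{C}$ of cliques of $G$ such that every edge of $G$ is contained in at least one clique of $\mathcal{C}$; it is a $k$-clique covering if every vertex belongs to at most $k$ cliques of $\mathcal{C}$. $\mathrm{lcc}(G)$ is the smallest $k$ such that $G$ admits a $k$-clique covering. Logarithms are base $2$. *)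

(* Defs.v *)
From mathcomp Require Import all_boot all_order all_algebra.
From mathcomp Require Import reals exp.

Set Implicit Arguments.
Unset Strict Implicit.
Unset Printing Implicit Defensive.

Import Order.TTheory GRing.Theory Num.Theory.

Record sgraph := SGraph {
  vert :> finType;
  adj : rel vert;
  adj_sym : symmetric adj;
  adj_irr : irreflexive adj }.

Section CliqueCovering.
Variable G : sgraph.
Implicit Types (A : {set G}) (C : {set {set G}}).

(* Cliques need not be maximal. *)
Definition clique A : bool :=
  [forall x in A, forall y in A, (x != y) ==> adj x y].

Definition clique_covering C : bool :=
  [forall A in C, clique A] &&
  [forall x, forall y, adj x y ==> [exists A in C, (x \in A) && (y \in A)]].

Definition k_clique_covering (k : nat) C : bool :=
  clique_covering C && [forall x : G, #|[set A in C | x \in A]| <= k].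

(* Families are sets of cliques: deleting repeated members of an indexed
   family keeps it a covering and does not increase any vertex count, so the
   minimum below is the same with or without repetitions. *)
Definition has_k_clique_covering (k : nat) : bool :=
  [exists C : {set {set G}}, k_clique_covering k C].

Lemma has_k_clique_covering_ex : exists k, has_k_clique_covering k.
Proof.
exists #|{set G}|; apply/existsP; exists [set A | clique A].
apply/andP; split; last first.
  by apply/forallP => x; rewrite max_card.
apply/andP; split; first by apply/forall_inP => A; rewrite inE.
apply/forallP => x; apply/forallP => y; apply/implyP => exy.
apply/exists_inP; exists [set x; y]; last by rewrite !inE !eqxx orbT.
rewrite inE; apply/forall_inP => a; rewrite !inE => Ha.
apply/forall_inP => b; rewrite !inE => Hb; apply/implyP.
by case/orP: Ha => /eqP->; case/orP: Hb => /eqP->;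
  rewrite ?eqxx // [adj y x]adj_sym.
Qed.

Definition lcc : nat := ex_minn has_k_clique_covering_ex.

End CliqueCovering.

Section Knabla.
Variable n : nat.

(* Vertex v + 1 of {1, ..., 2n} is represented by v : 'I_(2 * n), so that
   X is v < n and Y is n <= v; the condition j <= n + i is unchanged by the
   simultaneous shift of i and j. *)
Definition inX (v : 'I_(2 * n)) : bool := v < n.

Definition Knabla_adj : rel 'I_(2 * n) := fun i j =>
  (i != j) &&
  match inX i, inX j with
  | true, true | false, false => true
  | true, false => j <= n + i
  | false, true => i <= n + j
  end.

Lemma Knabla_adj_sym : symmetric Knabla_adj.
Proof.
by move=> i j; rewrite /Knabla_adj eq_sym; case: (inX i); case: (inX j).
Qed.

Lemma Knabla_adj_irr : irreflexive Knabla_adj.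
Proof. by move=> i; rewrite /Knabla_adj eqxx. Qed.

Definition Knabla : sgraph := SGraph Knabla_adj_sym Knabla_adj_irr.

End Knabla.

Definition log2 (R : realType) (x : R) : R := (ln x / ln 2)%R.

(* Main.v *)
(** A clique of [Knabla n] meeting both sides has a threshold: all its vertices
in [Y] lie below it and all its vertices in [X] lie above it. Only thresholds
matter, so a clique covering becomes a choice, for each position [i], of sets
[A i] of thresholds [<= i] and [B i] of thresholds [> i] such that [B i] and
[A j] meet for all [i < j]. If [A] and [B] have at most [a] and [b] elements,
there are at most ['C(a + b, a)] positions: some threshold [t] can be used to
delete an element of every [B i] with [i < t] and of every [A i] with [t <= i],
and Pascal's rule applies to the two sides of [t]. Reading this recursion
backwards gives families attaining the bound. Hence [k = lcc (Knabla n)]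
satisfies ['C(2(k - 2), k - 2) <= n < 'C(2k, k)], and the theorem follows from
['C(2m, m)] being of order [4^m / sqrt m]. *)

Require Import Defs.
From mathcomp Require Import all_boot all_order all_algebra.
From mathcomp Require Import reals exp.
From mathcomp Require Import zify ring lra.
Import Order.TTheory GRing.Theory Num.Theory.

Set Implicit Arguments.
Unset Strict Implicit.
Unset Printing Implicit Defensive.

(** * Separating families of thresholds *)

Lemma count_lt (T : eqType) (p q : pred T) (s : seq T) (x : T) :
  subpred p q -> x \in s -> q x -> ~~ p x -> count p s < count q s.
Proof.
move=> pq xs qx npx; rewrite (permP (perm_to_rem xs)) /=.
rewrite [X in _ < X](permP (perm_to_rem xs)) /= qx (negbTE npx) add0n.
by rewrite add1n ltnS sub_count.
Qed.

(** Positions form a window [[lo, hi)], so that the same families can be restricted to either side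
    of a splitting threshold. *)
Definition separates (A B : nat -> seq nat) (lo hi : nat) : Prop :=
  forall i j, lo <= i -> i < j -> j < hi ->
    exists t, [/\ i < t, t <= j, t \in B i & t \in A j].

(** Take the largest [t] such that some [A m] with [m >= t] has no threshold strictly between [lo]
    and [t]. For [i < t], what [B i] shares with this [A m] is at least [t]. For [i > t], maximality
    gives [A i] a threshold in [(lo, t]]; for [i = t], the one shared with [B lo] serves. *)
Lemma separates_split (A B : nat -> seq nat) (lo hi : nat) :
    separates A B lo hi -> lo.+1 < hi ->
  exists t, [/\ lo < t < hi,
    forall i, lo <= i < t -> exists2 s, s \in B i & t <= s < hi &
    forall i, t <= i < hi -> exists2 s, s \in A i & lo < s <= t].
Proof.
move=> AB lo_hi.
pose P t := [exists i : 'I_hi, (lo < t <= i) &&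
               ~~ has (fun s => lo < s < t) (A i)].
have exP : exists t, P t.
  exists lo.+1; apply/existsP; exists (Ordinal lo_hi); rewrite /= !leqnn /=.
  by apply/hasPn => s _; lia.
have leP t : P t -> t <= hi by case/existsP => i /andP[]; have := ltn_ord i; lia.
case: (ex_maxnP exP leP) => t Pt tmax; exists t.
case/existsP: (Pt) => m /andP[/andP[lo_t t_m] /hasPn noA].
have m_hi := ltn_ord m; split=> [|i /andP[lo_i i_t]|i /andP[t_i i_hi]].
- by lia.
- have [s [i_s s_m sB sA]] := AB i m lo_i (leq_trans i_t t_m) m_hi.
  by exists s => //; have := noA s sA; lia.
- have [ti|i_t] := ltnP t i; last first.
    have [s [lo_s s_i _ sA]] := AB lo i (leqnn _) (leq_trans lo_t t_i) i_hi.
    by exists s => //; lia.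
  suff /hasP[s sA s_t] : has (fun s => lo < s < t.+1) (A i) by exists s.
  apply: contraT => noAi; suff /tmax : P t.+1 by rewrite ltnn.
  by apply/existsP; exists (Ordinal i_hi); rewrite noAi /= andbT; lia.
Qed.

(** Only thresholds inside the window are counted, so shrinking it to one side of [t] discards the
    elements found by [separates_split]: one from each [B i] with [i < t], one from each [A i] with
    [t <= i]. *)
Lemma separates_bound (a b lo hi : nat) (A B : nat -> seq nat) :
    separates A B lo hi ->
    (forall i, lo <= i < hi -> count (fun t => lo < t <= i) (A i) <= a) ->
    (forall i, lo <= i < hi -> count (fun t => i < t < hi) (B i) <= b) ->
  hi - lo <= 'C(a + b, a).
Proof.
move def_s : (a + b) => s.
elim: s => [|s IHs] in a b lo hi def_s * => AB cA cB;
  (have [small|lo_hi] := leqP (hi - lo) 1;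
    first by apply: leq_trans small _; rewrite bin_gt0; lia);
  (have [|t [lo_t_hi tB tA]] := separates_split AB; first by lia).
all: have cB' i : lo <= i < t -> count (fun r => i < r < t) (B i) < b.
1,3: move=> lo_i_t; have [r rB t_r] := tB i lo_i_t;
     (apply: leq_trans (cB i _); last by lia);
     by apply: (count_lt (x := r)) => // [u||]; lia.
all: have cA' i : t <= i < hi -> count (fun r => t < r <= i) (A i) < a.
1,3: move=> t_i_hi; have [r rA r_t] := tA i t_i_hi;
     (apply: leq_trans (cA i _); last by lia);
     by apply: (count_lt (x := r)) => // [u||]; lia.
  by have := cB' lo; lia.
have b_gt0 : 0 < b by have := cB' lo; lia.
have a_gt0 : 0 < a by have := cA' t; lia.
case: a b a_gt0 b_gt0 def_s cA cB cA' cB' => [|a] [|b] // _ _ def_s cA cB cA' cB'.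
have low : t - lo <= 'C(s, a.+1).
  apply: (IHs a.+1 b); first by lia.
  - by move=> i j lo_i i_j j_t; apply: AB => //; lia.
  - by move=> i lo_i_t; apply: cA; lia.
  - by move=> i lo_i_t; apply: cB'.
have high : hi - t <= 'C(s, a).
  apply: (IHs a b.+1); first by lia.
  - by move=> i j t_i i_j j_hi; apply: AB => //; lia.
  - by move=> i t_i_hi; apply: cA'.
  - by move=> i t_i_hi; apply: cB; lia.
by rewrite binS; lia.
Qed.

Lemma separates_exist (a b lo hi : nat) : hi - lo <= 'C(a + b, a) ->
  exists A B, [/\ separates A B lo hi,
    forall i, size (A i) <= a & forall i, size (B i) <= b].
Proof.
have trivial c d l h : h - l <= 1 -> exists A B, [/\ separates A B l h,
    forall i, size (A i) <= c & forall i, size (B i) <= d].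
  by move=> lh; exists (fun=> [::]), (fun=> [::]); split=> // i j; lia.
move def_s : (a + b) => s.
elim: s => [|s IHs] in a b lo hi def_s * => lo_hi.
  by apply: trivial; move: lo_hi; have -> : a = 0 by lia.
case: a def_s lo_hi => [|a] def_s lo_hi.
  by apply: trivial; rewrite bin0 in lo_hi.
case: b def_s => [|b] def_s.
  apply: trivial; move: lo_hi.
  by rewrite -def_s addn0 binn.
rewrite binS in lo_hi.
(* The low side takes one Pascal term; [minn] leaves the high side empty when the window is
   short. *)
have [t def_t] : exists t, t = minn hi (lo + 'C(s, a.+1)) by eexists.
have [||A1 [B1 [sep1 A1a B1b]]] := IHs a.+1 b lo t; [lia|lia|].
have [||A2 [B2 [sep2 A2a B2b]]] := IHs a b.+1 t hi; [lia|lia|].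
(* Each side spends its spare unit on [t], which handles all pairs [i < t <= j]. *)
exists (fun i => if i < t then A1 i else t :: A2 i).
exists (fun i => if i < t then t :: B1 i else B2 i).
split=> [i j lo_i i_j j_hi|i|i]; last 2 first.
- by case: ifP => _ //=; rewrite ltnS.
- by case: ifP => _ //=; rewrite ltnS.
have [i_t|t_i] := ltnP i t; have [j_t|t_j] := ltnP j t.
- have [r [? ? rB rA]] := sep1 i j lo_i i_j j_t.
  by exists r; split; rewrite // inE rB orbT.
- by exists t; rewrite !inE eqxx.
- by lia.
- have [r [? ? rB rA]] := sep2 i j t_i i_j j_hi.
  by exists r; split; rewrite // inE rA orbT.
Qed.

(** * Clique coverings of [Knabla n] and separating families *)

Lemma lcc_covering (G : sgraph) : has_k_clique_covering G (lcc G).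
Proof. by rewrite /lcc; case: ex_minnP. Qed.

Lemma lcc_le (G : sgraph) (k : nat) : has_k_clique_covering G k -> lcc G <= k.
Proof. by rewrite /lcc; case: ex_minnP => m _ mP /mP. Qed.

Lemma Knabla_lt_bin (n : nat) :
  n < 'C((lcc (Knabla n)).*2, lcc (Knabla n)).
Proof.
set k := lcc _; rewrite -addnn.
have /existsP[C /andP[/andP[/forall_inP cC /forallP covC] /forallP degC]] :=
  lcc_covering (Knabla n).
(* For a clique meeting [Y], [th c] is the least threshold above the positions of its vertices in
   [Y]. *)
pose top (c : {set Knabla n}) := \max_(v in c) val (v : 'I_(2 * n)).
pose th c := (top c).+1 - n.
(* Adjacency [j <= n + i] is non-strict, hence the shift: position [i + 1]
   stands for the vertex [i] of [X], position [j - n] for the vertex [j] of [Y],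
   which makes [n + 1] positions. *)
pose lab (v : nat) : seq nat :=
  if insub v is Some w then
    [seq th c | c <- enum [set c in C | (w : Knabla n) \in c]] else [::].
have size_lab v : size (lab v) <= k.
  rewrite /lab; case: insubP => [w _ _|] //.
  by rewrite size_map -cardE degC.
rewrite -[n.+1]subn0.
(* Default values occur at the ends: [0.-1 = 0], and [lab (n + n)] is empty. Separation only
   consults [A j] with [0 < j] and [B i] with [i < n]. *)
apply: (@separates_bound k k 0 n.+1 (fun i => lab i.-1) (fun i => lab (n + i)));
  last 2 first.
- by move=> i _; apply: leq_trans (count_size _ _) (size_lab _).
- by move=> i _; apply: leq_trans (count_size _ _) (size_lab _).
move=> i j _ i_j j_n.
have iP : n + i < 2 * n by lia.
have jP : j.-1 < 2 * n by lia.
pose y : Knabla n := Ordinal iP; pose x : Knabla n := Ordinal jP.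
have adj_yx : adj y x.
  by rewrite /= /Knabla_adj /inX -val_eqE /=; do 2?case: ifP; lia.
have /forallP/(_ x)/implyP/(_ adj_yx)/exists_inP[c cC' /andP[yc xc]] := covC y.
have in_lab (v : Knabla n) : v \in c -> th c \in lab v.
  move=> vc; rewrite /lab (valK (v : 'I_(2 * n))); apply: map_f.
  by rewrite mem_enum inE cC'.
exists (th c); split; last 2 first.
- exact: (in_lab y).
- exact: (in_lab x).
- have : n + i <= top c.
    exact: (@leq_bigmax_cond _ (mem c) (fun v : 'I_(2 * n) => val v) y yc).
  by rewrite /th; lia.
(* Every other vertex of [c] is adjacent to [x], which lies in [X]. *)
suff : top c <= n + j.-1 by rewrite /th; lia.
apply/bigmax_leqP => v vc.
have [->/=|v_x] := eqVneq v x; first by lia.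
have /forall_inP/(_ x xc)/implyP/(_ v_x) := forall_inP (cC c cC') v vc.
rewrite /= /Knabla_adj /inX /=; have := ltn_ord (v : 'I_(2 * n)).
by case: ifP; case: ifP; lia.
Qed.

(** The two sides cover the edges inside [X] and inside [Y] and cost each vertex one clique, whence
    [k.+1]. The cliques [cl t] cover the crossing edges: [y <= n + x] leaves room for a common [t]
    with [y - n < t <= x.+1]. *)
Lemma Knabla_lcc_le (n k : nat) : n < 'C(k.*2, k) -> lcc (Knabla n) <= k.+1.
Proof.
rewrite -addnn -[n.+1]subn0.
case/separates_exist => A [B [AB szA szB]]; apply: lcc_le; apply/existsP.
pose side (b : bool) : {set Knabla n} := [set v | inX v == b].
pose lab (v : 'I_(2 * n)) := if inX v then A v.+1 else B (v - n).
pose cl (t : nat) : {set Knabla n} :=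
  [set v : 'I_(2 * n) | (if inX v then t <= v.+1 else v - n < t) & t \in lab v].
exists ([set side b | b : bool] :|: [set cl t | t : 'I_n.+1]).
apply/andP; split; first (apply/andP; split).
- apply/forall_inP => c; rewrite inE => /orP[] /imsetP[t _ ->];
    apply/forall_inP => u; rewrite inE => Hu;
    apply/forall_inP => v; rewrite inE => Hv; apply/implyP => u_v.
    by move: Hu Hv; rewrite /= /Knabla_adj u_v /= => /eqP-> /eqP->; case: t.
  case/andP: Hu => + _; case/andP: Hv => + _; rewrite /= /Knabla_adj u_v /=.
  by case: ifP; case: ifP => //; rewrite /inX; lia.
- have crossing (x y : 'I_(2 * n)) : inX x -> ~~ inX y -> y <= n + x ->
      exists2 t : 'I_n.+1, x \in cl t & y \in cl t.
    rewrite /inX => x_n n_y y_x; have y_lt := ltn_ord y.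
    have [||t [y_t t_x tB tA]] := AB (y - n) x.+1 (leq0n _); [lia|lia|].
    have t_n : t < n.+1 by lia.
    exists (Ordinal t_n); rewrite inE /= /lab /inX.
      by rewrite x_n t_x.
    by rewrite (negbTE n_y) y_t.
  apply/forallP => u; apply/forallP => v; apply/implyP => uv.
  apply/exists_inP; move: uv; rewrite /= /Knabla_adj => /andP[_].
  have [uX|uY] := boolP (inX u); have [vX|vY] := boolP (inX v) => uv.
  + by exists (side true); rewrite !inE ?uX ?vX // imset_f.
  + have [t ut vt] := crossing u v uX vY uv.
    by exists (cl t); rewrite ?ut ?vt // inE [X in _ || X]imset_f ?orbT.
  + have [t ut vt] := crossing v u vX uY uv.
    by exists (cl t); rewrite ?ut ?vt // inE [X in _ || X]imset_f ?orbT.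
  + by exists (side false); rewrite !inE ?(negbTE uY) ?(negbTE vY) // imset_f.
apply/forallP => v.
pose S := [set t : 'I_n.+1 | val t \in lab v].
have cardS : #|S| <= k.
  rewrite cardE -(size_map val); apply: (@leq_trans (size (lab v))).
    apply: uniq_leq_size; first by rewrite (map_inj_uniq val_inj) enum_uniq.
    by move=> _ /mapP[t + ->]; rewrite mem_enum inE.
  by rewrite /lab; case: ifP.
apply: (@leq_trans #|side (inX v) |: [set cl (val t) | t in S]|).
  apply: subset_leq_card; apply/subsetP => c; rewrite !inE => /andP[+ vc].
  case/orP => /imsetP[t _ def_c]; subst c.
    by move: vc; rewrite inE => /eqP<-; rewrite eqxx.
  by apply/orP; right; apply: imset_f; move: vc; rewrite !inE => /andP[].
rewrite cardsU1 -[k.+1]add1n leq_add ?leq_b1 //.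
exact: leq_trans (leq_imset_card _ _) cardS.
Qed.

(** * Estimates of central binomial coefficients *)

Lemma central_binS (m : nat) :
  m.+1 * 'C(m.+1.*2, m.+1) = 2 * (m.*2.+1 * 'C(m.*2, m)).
Proof.
rewrite doubleS -mul_bin_diag /=.
have -> : 'C(m.*2.+1, m) = 'C(m.*2.+1, m.+1).
  by rewrite -bin_sub; [congr 'C(_, _); lia|lia].
have := mul_bin_diag m.*2.+1 m; rewrite /= => ->.
by rewrite -doubleS -mul2n mulnA.
Qed.

(** After cancellation the induction step is [(2m + 3)(2m + 1) <= (2m + 2)^2]. *)
Lemma central_bin_ub (m : nat) : m.*2.+1 * 'C(m.*2, m) ^ 2 <= 16 ^ m.
Proof.
elim: m => [//|m IHm]; rewrite -(@leq_pmul2l (m.+1 ^ 2)) ?expn_gt0 //.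
rewrite mulnCA -expnMn central_binS [16 ^ _]expnS.
apply: (@leq_trans (4 * (m.+1.*2.+1 * m.*2.+1) * 16 ^ m)).
  apply: leq_trans (leq_mul (leqnn _) IHm).
  by apply: eq_leq; ring.
by rewrite [X in _ <= X]mulnA leq_mul2r; apply/orP; right; nia.
Qed.

(** Equality holds at [m = 1]; the step from [m] to [m + 1] is [4m(m + 1) <= (2m + 1)^2]. *)
Lemma central_bin_lb (m : nat) : 0 < m -> 16 ^ m <= 4 * m * 'C(m.*2, m) ^ 2.
Proof.
case: m => // m _; elim: m => [//|m IHm].
rewrite -(@leq_pmul2l (m.+2 ^ 2)) ?expn_gt0 //.
rewrite [X in _ <= X]mulnCA -expnMn central_binS [16 ^ _]expnS.
apply: (@leq_trans (16 * m.+2 ^ 2 * (4 * m.+1 * 'C(m.+1.*2, m.+1) ^ 2))).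
  by rewrite mulnCA mulnA leq_mul2l IHm orbT.
rewrite !expnMn !mulnA leq_mul2r; apply/orP; right.
by nia.
Qed.

(** * Base 2 logarithms and the final estimate *)

Local Open Scope ring_scope.

Section Log2.
Variable R : realType.
Implicit Types x y : R.

Let ln2_gt0 : 0 < ln (2 : R). Proof. by rewrite ln_gt0 // ltr1n. Qed.

Lemma log2_2 : log2 (2 : R) = 1.
Proof. by rewrite /log2 divff // gt_eqF. Qed.

Lemma log2M x y : 0 < x -> 0 < y -> log2 (x * y) = log2 x + log2 y.
Proof. by move=> x0 y0; rewrite /log2 lnM ?posrE // mulrDl. Qed.

Lemma log2X x (m : nat) : 0 < x -> log2 (x ^+ m) = m%:R * log2 x.
Proof. by move=> x0; rewrite /log2 lnXn // -[X in X / _]mulr_natl mulrA. Qed.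

Lemma le_log2 x y : 0 < x -> x <= y -> log2 x <= log2 y.
Proof.
move=> x0 xy; rewrite /log2 ler_pM2r ?invr_gt0 // ler_ln // posrE //.
exact: lt_le_trans x0 xy.
Qed.

Lemma log2_ge0 x : 1 <= x -> 0 <= log2 x.
Proof. by move=> x1; apply: divr_ge0; [exact: ln_ge0|exact: ltW]. Qed.

End Log2.

Theorem theorem3 (R : realType) :
  exists C : R, forall n : nat, (2 <= n)%N ->
    `| (lcc (Knabla n))%:R
       - (1 / 2 * log2 n%:R + 1 / 4 * log2 (log2 n%:R)) | <= C.
Proof.
(* The error lies between 0 and [5 / 2]: 2 comes from [k = m + 2], and [1 / 2] from the factor 4 in
   [central_bin_lb]. *)
exists (5 / 2) => n n_ge2.
have n_lt := Knabla_lt_bin n; have := @Knabla_lcc_le n.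
set k := lcc _ in n_lt * => lcc_le.
have [m def_k] : exists m, k = m.+2.
  case: k n_lt {lcc_le} => [|[|m]] //; last by exists m.
    by rewrite bin0; lia.
  by rewrite bin1; lia.
have m_le : ('C(m.*2, m) <= n)%N by rewrite leqNgt; apply/negP => /lcc_le; lia.
have log16 : log2 (16 : R) = 4.
  by have -> : (16 : R) = 2 ^+ 4 by [ring]; rewrite log2X // log2_2 mulr1.
have n_gt0 : 0 < n%:R :> R by rewrite ltr0n; lia.
set L := log2 n%:R.
have L_ge1 : 1 <= L by rewrite -(log2_2 R) le_log2 // ler_nat.
have logL_ge0 : 0 <= log2 L := log2_ge0 L_ge1.
have lower : 2 * L + log2 L <= 4 * k%:R.
  have : (k.*2.+1 * n ^ 2 <= 16 ^ k)%N.
    by apply: leq_trans (central_bin_ub k); rewrite leq_mul2l leq_sqr ltnW ?orbT.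
  have n2_gt0 : 0 < n%:R ^+ 2 :> R by rewrite exprn_gt0.
  have k_gt0 : 0 < k.*2.+1%:R :> R by rewrite ltr0n.
  rewrite -(ler_nat R) natrM !natrX => /(le_log2 (mulr_gt0 k_gt0 n2_gt0)).
  rewrite log2M // !log2X // log16 -/L => le_4k.
  have log_ge0 : 0 <= log2 (k.*2.+1%:R : R) by rewrite log2_ge0 ?ler1n.
  (* Bootstrapping: [le_4k] without its logarithm of [2k + 1] already gives [L <= 2k], which bounds
     that logarithm below by [log2 L]. *)
  have : log2 L <= log2 k.*2.+1%:R; last by lra.
  have kE : k.*2.+1%:R = 2 * k%:R + 1 :> R by rewrite -natr1 -mul2n natrM.
  by apply: le_log2; lra.
have upper : 4 * m%:R <= 2 + log2 L + 2 * L.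
  case: (posnP m) => [->|m_gt0]; first by lra.
  have m0 : 0 < m%:R :> R by rewrite ltr0n.
  have m16 : (16 ^ m <= 4 * m * n ^ 2)%N.
    apply: leq_trans (central_bin_lb m_gt0) _.
    by rewrite leq_mul2l leq_sqr m_le orbT.
  (* This crude bound turns [m16] into [2 ^ m <= n], hence [m <= L]; then [log2 L] can replace
     [log2 m] in the logarithm of [m16]. *)
  have le_4m : (4 * m <= 4 ^ m)%N.
    rewrite -[X in (_ <= 4 ^ X)%N](prednK m_gt0) expnS leq_mul2l /=.
    by rewrite -{1}(prednK m_gt0) ltn_expl.
  have m_L : m%:R <= L.
    have : (2 ^ m <= n)%N.
      rewrite -leq_sqr -(@leq_pmul2l (4 ^ m)) ?expn_gt0 //.
      rewrite -expnM (mulnC m) expnM -expnMn; apply: leq_trans m16 _.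
      by rewrite leq_mul2r le_4m orbT.
    rewrite -(ler_nat R) natrX => /(le_log2 (exprn_gt0 _ (ltr0Sn R 1))).
    by rewrite log2X // log2_2 mulr1.
  have log_m := le_log2 m0 m_L.
  have log4 : log2 (4 : R) = 2.
    by have -> : (4 : R) = 2 ^+ 2 by [ring]; rewrite log2X // log2_2 mulr1.
  move: m16; rewrite -(ler_nat R) natrX natrM natrX natrM.
  move=> /(le_log2 (exprn_gt0 _ (ltr0Sn R 15))).
  rewrite log2M ?exprn_gt0 ?mulr_gt0 // log2M // !log2X // log16 log4 -/L.
  by lra.
have kE : k%:R = m%:R + 2 :> R by rewrite def_k -addn2 natrD.
by rewrite ler_norml; apply/andP; split; lra.
Qed.
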